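(* Let $U$ be a supertropical semiring, $M:=eU$, $x\in\mathcal T(U)$ and $a:=ex$. The following are equivalent. (i) $x$ cannot be isolated in $U$. (ii) There exist $u,v,w\in[a:a]_U$ such that $uvx\in\mathcal T(U)$, $wx\in\mathcal T(U)$, but $uwx\in M$ (hence $uwx=a$).
   Context: A supertropical semiring is a commutative semiring $U$ such that $e:=1+1$ is idempotent ($e+e=e$) and, for all $a,b\in U$, $a+b\in\{a,b\}$ if $ea\ne eb$, and $a+b=ea$ if $ea=eb$. (Then $ea=0\Rightarrow a=0$.) $M=eU$ is the set of ghosts and $\mathcal T(U):=U\setminus eU$ the set of tangible elements. An MFCE-relation on $U$ is an equivalence relation $E$ with $x\sim_Ey\Rightarrow xz\sim_Eyz$ for all $z\in U$, and $x\sim_Ey\Rightarrow ex=ey$. In $U/E$ the ghosts are the classes $[a]_E$, $a\in M$ (identified with $M$); the other classes are tangible. For $a\in M$, $[a:a]_U:=\{u\in U\mid ua=a\}$. For $x\in\mathcal T(U)$ and $c\in M$, $\mathrm S_c(x):=\{z\in Ux\cap\mathcal T(U)\mid ez=c\}$. With $a:=ex$, the isolating relation $\mathrm{Is}(x)$ is the finest MFCE-relation $E$ on $U$ such that $s\sim_Et$ for all $s,t\in\mathrm S_a(x)$. One says that $x$ can be isolated in $U$ if $[x]_{\mathrm{Is}(x)}$ is tangible in $U/\mathrm{Is}(x)$, and that $x$ cannot be isolated if $[x]_{\mathrm{Is}(x)}$ is ghost. *)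

(* Defs.v *)
From mathcomp Require Import all_boot all_algebra.
From mathcomp Require Import boolp classical_sets.
From Corelib Require Import RelationClasses.

Set Implicit Arguments.
Unset Strict Implicit.
Unset Printing Implicit Defensive.

Import GRing.Theory.
Local Open Scope classical_set_scope.
Local Open Scope ring_scope.

Definition ghost_unit (U : comPzSemiRingType) : U := 1 + 1.

Record supertropical (U : comPzSemiRingType) : Prop := Supertropical {
  ghost_unit_idem : ghost_unit U + ghost_unit U = ghost_unit U;
  supertropical_neq : forall a b : U,
    ghost_unit U * a <> ghost_unit U * b -> a + b = a \/ a + b = b;
  supertropical_eq : forall a b : U,
    ghost_unit U * a = ghost_unit U * b -> a + b = ghost_unit U * a }.

Definition ghosts (U : comPzSemiRingType) : set U :=
  [set ghost_unit U * u | u in [set: U]].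
Arguments ghosts : clear implicits.

Definition tangibles (U : comPzSemiRingType) : set U := ~` ghosts U.
Arguments tangibles : clear implicits.

Record MFCE (U : comPzSemiRingType) (E : U -> U -> Prop) : Prop := MkMFCE {
  MFCE_equiv : Equivalence E;
  MFCE_mul : forall x y z : U, E x y -> E (x * z) (y * z);
  MFCE_ghost : forall x y : U, E x y -> ghost_unit U * x = ghost_unit U * y }.

(* Elements of the quotient U/E are represented as subsets of U. *)
Definition eqclass (U : comPzSemiRingType) (E : U -> U -> Prop) (x : U) :
  set U := [set y | E x y].

Definition quotient (U : comPzSemiRingType) (E : U -> U -> Prop) :
  set (set U) := [set eqclass E x | x in [set: U]].

Definition ghost_classes (U : comPzSemiRingType) (E : U -> U -> Prop) :
  set (set U) := [set eqclass E b | b in ghosts U].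

Definition tangible_classes (U : comPzSemiRingType) (E : U -> U -> Prop) :
  set (set U) := quotient E `\` ghost_classes E.

(* [a : a]_U *)
Definition stabilizer (U : comPzSemiRingType) (a : U) : set U :=
  [set u | u * a = a].

(* S_c(x) *)
Definition tangible_fiber (U : comPzSemiRingType) (c x : U) : set U :=
  [set z | ([set u * x | u in [set: U]] `&` tangibles U) z
           /\ ghost_unit U * z = c].

Definition identifies (U : comPzSemiRingType) (S : set U)
  (E : U -> U -> Prop) : Prop := forall s t : U, S s -> S t -> E s t.

(* Is(x), obtained as the intersection of all admissible relations; the three
   lemmas below show that it is the finest of them. *)
Definition isolating (U : comPzSemiRingType) (x : U) : U -> U -> Prop :=
  fun y z => forall E : U -> U -> Prop, MFCE E ->
    identifies (tangible_fiber (ghost_unit U * x) x) E -> E y z.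

Definition can_be_isolated (U : comPzSemiRingType) (x : U) : Prop :=
  tangible_classes (isolating x) (eqclass (isolating x) x).

Definition cannot_be_isolated (U : comPzSemiRingType) (x : U) : Prop :=
  ghost_classes (isolating x) (eqclass (isolating x) x).

Lemma isolating_identifies (U : comPzSemiRingType) (x : U) :
  identifies (tangible_fiber (ghost_unit U * x) x) (isolating x).
Proof. by move=> s t Ss St E _; apply. Qed.

Lemma isolating_finest (U : comPzSemiRingType) (x : U) (E : U -> U -> Prop) :
  MFCE E -> identifies (tangible_fiber (ghost_unit U * x) x) E ->
  forall y z : U, isolating x y z -> E y z.
Proof. by move=> mE iE y z; apply. Qed.

Lemma isolating_MFCE (U : comPzSemiRingType) (x : U) : MFCE (isolating x).
Proof.
have same_ghost_MFCE :
    MFCE (fun y z : U => ghost_unit U * y = ghost_unit U * z).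
  split=> [|y z w yz|//]; last by rewrite !mulrA yz.
  by split=> [y //|y z ->|y z w -> ->].
split.
- split.
  + by move=> y E [[rE _ _] _ _] _; exact: rE.
  + by move=> y z yz E mE iE; case: (mE) => -[_ sE _] _ _; exact: sE (yz E mE iE).
  + move=> y z w yz zw E mE iE; case: (mE) => -[_ _ tE] _ _.
    exact: tE (yz E mE iE) (zw E mE iE).
- by move=> y z w yz E mE iE; apply: MFCE_mul => //; apply: yz.
- move=> y z yz; apply: (yz _ same_ghost_MFCE).
  by move=> s t [_ ->] [_ ->].
Qed.

Lemma cannot_be_isolatedE (U : comPzSemiRingType) (x : U) :
  cannot_be_isolated x <-> ~ can_be_isolated x.
Proof.
split=> [gx [_ ngx] //|ncx]; apply: contrapT => ngx.
by apply: ncx; split=> //; exists x.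
Qed.

(* Main.v *)
Require Import Defs.
From mathcomp Require Import all_boot all_algebra.
From mathcomp Require Import boolp classical_sets.

Import GRing.Theory.
Local Open Scope classical_set_scope.
Local Open Scope ring_scope.

(** Put [S := S_a(x)]; it consists of the tangible [ux] with [u] in [[a:a]].
    Given (ii), [vx] and [wx] lie in [S], so [Is(x)] identifies them; multiplying
    by [u] and using that [uvx] lies in [S] gives [x ~ uvx ~ uwx = a].
    Conversely, consider the syntactic congruence of [S]: [y ~ z] when [ey = ez]
    and every [p] satisfies [py] in [S] iff [pz] in [S]. It is an MFCE-relation
    which never relates [x] (a member of [S]) to a ghost, and the failure of (ii)
    says precisely that it identifies all members of [S]. *)

Lemma ghost_unit_mul_idem (U : comPzSemiRingType) (hU : supertropical U) :
  ghost_unit U * ghost_unit U = ghost_unit U.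
Proof. by rewrite {1}/ghost_unit mulrDl mul1r; exact: ghost_unit_idem hU. Qed.

Lemma ghosts_fix (U : comPzSemiRingType) (hU : supertropical U) (y : U) :
  ghosts U y -> ghost_unit U * y = y.
Proof. by move=> [z _ <-]; rewrite mulrA ghost_unit_mul_idem. Qed.

Lemma ghostsMl (U : comPzSemiRingType) (u y : U) :
  ghosts U y -> ghosts U (u * y).
Proof. by move=> [z _ <-]; exists (u * z) => //; rewrite mulrCA. Qed.

Lemma tangiblesMl (U : comPzSemiRingType) (u y : U) :
  tangibles U (u * y) -> tangibles U y.
Proof. by move=> tuy gy; apply: tuy; apply: ghostsMl. Qed.

Lemma stabilizerM (U : comPzSemiRingType) (a u v : U) :
  stabilizer a u -> stabilizer a v -> stabilizer a (u * v).
Proof. by rewrite /stabilizer /= -mulrA => ua ->. Qed.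

(** Since [e(ux) = u(ex)], the ghost condition on [ux] becomes a condition on the multiplier: [u]
    fixes [ex]. *)
Lemma tangible_fiberP (U : comPzSemiRingType) (x z : U) :
  tangible_fiber (ghost_unit U * x) x z <->
  exists u, [/\ stabilizer (ghost_unit U * x) u, tangibles U (u * x)
              & z = u * x].
Proof.
split=> [[[[u _ <-] tux] eux]|[u [su tux ->]]].
  by exists u; split=> //; rewrite /stabilizer /= mulrCA.
by split; [split=> //; exists u | rewrite mulrCA].
Qed.

Lemma tangible_fiber_refl {U : comPzSemiRingType} {x : U} :
  tangibles U x -> tangible_fiber (ghost_unit U * x) x x.
Proof.
by move=> tx; apply/tangible_fiberP; exists 1; rewrite /stabilizer /= !mul1r.
Qed.

Lemma cannot_be_isolatedP (U : comPzSemiRingType) (x : U) :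
  cannot_be_isolated x <-> exists2 b, ghosts U b & isolating x x b.
Proof.
have [[rE sE tE] _ _] := isolating_MFCE x.
split=> [[b gb xb]|[b gb xb]]; exists b => //.
  have: eqclass (isolating x) b b by exact: rE.
  by rewrite xb.
by apply/seteqP; split=> y /=; apply: tE => //; apply: sE.
Qed.

(** Contexts are products only, as an MFCE-relation need not respect sums; left factors suffice by
    commutativity. *)
Definition syntactic {U : comPzSemiRingType} (S : set U) (y z : U) : Prop :=
  ghost_unit U * y = ghost_unit U * z /\ forall p, S (p * y) <-> S (p * z).

Lemma syntactic_MFCE (U : comPzSemiRingType) (S : set U) : MFCE (syntactic S).
Proof.
split.
- split=> [y|y z [yz h]|y z w [yz h] [zw k]]; split=> //.
  + by move=> p; split=> /h.
  + by rewrite yz.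
  + by move=> p; split=> [/h/k|/k/h].
- move=> y z w [yz h]; split=> [|p]; first by rewrite !mulrA yz.
  by rewrite ![_ * w]mulrC !mulrA.
- by move=> y z [].
Qed.

Theorem theorem7p9 (U : comPzSemiRingType) (hU : supertropical U)
  (x a : U) (hx : tangibles U x) (ha : a = ghost_unit U * x) :
  (cannot_be_isolated x <->
   exists u v w : U,
     [/\ stabilizer a u, stabilizer a v & stabilizer a w] /\
     [/\ tangibles U (u * v * x), tangibles U (w * x)
       & ghosts U (u * w * x)])
  /\ (forall u w : U, stabilizer a u -> stabilizer a w ->
        ghosts U (u * w * x) -> u * w * x = a).
Proof.
subst a; split; last first.
  (* A ghost is fixed by [e], so [uwx = e(uwx) = (uw)(ex)]. *)
  move=> u w su sw /(ghosts_fix _ hU) <-.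
  by rewrite mulrCA; apply: stabilizerM.
rewrite cannot_be_isolatedP; split=> [[b gb xb]|].
  apply: contrapT => nii.
  pose S := tangible_fiber (ghost_unit U * x) x.
  have S_tr p s t : S s -> S t -> S (p * s) -> S (p * t).
    move=> /tangible_fiberP[s' [ss ts ->]] /tangible_fiberP[t' [st tt ->]].
    move=> [[_ tps] eps].
    (* [s'] fixes [ex], so [ex = e(ps'x) = p(ex)]. *)
    have sp : stabilizer (ghost_unit U * x) p.
      by move: eps; rewrite mulrCA [_ * (s' * x)]mulrCA ss.
    apply/tangible_fiberP; exists (p * t'); split.
    - exact: stabilizerM.
    (* If [pt'x] were ghost while [ps'x] is tangible, then [p, s', t'] would witness (ii). *)
    - move=> gpt; apply: nii; exists p, s', t'; split=> //.
      by split=> //; rewrite -mulrA.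
    - by rewrite mulrA.
  have idS : identifies S (syntactic S).
    move=> s t Ss St; split=> [|p]; first by case: Ss St => [_ ->] [_ ->].
    by split; apply: S_tr.
  (* Testing with [p = 1]: [x] in [S] forces the ghost [b] into [S], whose elements are tangible. *)
  have [_ /(_ 1)] := xb _ (syntactic_MFCE _ S) idS.
  rewrite !mul1r => -[/(_ (tangible_fiber_refl hx)) Sb _].
  by case: Sb => -[_ /(_ gb)].
move=> [u [v [w [[su sv sw] [tuv tw guw]]]]].
exists (u * w * x) => //.
have [[_ _ tE] mE _] := isolating_MFCE x.
(* Pass through [uvx], which lies in the fibre together with [x]. *)
apply: (tE _ (u * v * x)).
  apply: isolating_identifies; first exact: tangible_fiber_refl.
  by apply/tangible_fiberP; exists (u * v); split=> //; apply: stabilizerM.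
rewrite -!mulrA ![u * _]mulrC; apply: mE.
apply: isolating_identifies; apply/tangible_fiberP.
  (* [vx] is tangible because its multiple [uvx] is. *)
  by exists v; split=> //; apply: (@tangiblesMl _ u); rewrite mulrA.
by exists w.
Qed.
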